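(* Let $\mathbb{X}$ be a Cartesian tangent category with a curve object $(C,c_1,c_0)$. A flow $((M,\gamma_1),\gamma_2)$ in the tangent category $\mathsf{FLOW}(\mathbb{X})$ (with respect to its curve object $((C,\pi_1),c_1,c_0)$) is precisely a pair of commuting flows $\gamma_1,\gamma_2$ on $M$ in $\mathbb{X}$; a flow $((M,V),\gamma)$ in the tangent category $\mathsf{CVF}(\mathbb{X})$ (with respect to its curve object $((C,0_C),c_1,c_0)$) is precisely a flow $\gamma$ on $M$ in $\mathbb{X}$ such that $V$ is invariant under $\gamma$.
   Context: Composition is written in diagrammatic order: $fg$ means first $f$, then $g$. A tangent category is a category $\mathbb{X}$ with a functor $T:\mathbb{X}\to\mathbb{X}$ and natural transformations $p:T\to 1$, $0:1\to T$, $+:T_2\to T$, $\ell:T\to T^2$, $c:T^2\to T^2$ such that: (1) for all $M,n$ the fibre power $T_nM$ of $n$ copies of $p_M:TM\to M$ exists and is preserved by every $T^k$; (2) $(p_M,+_M,0_M)$ is an additive bundle, i.e. a commutative monoid in $\mathbb{X}/M$; (3) $(\ell_M,0_M)$ is an additive bundle morphism (commuting square preserving addition and zero) from $(p_M,+_M,0_M)$ to $(T(p_M),T(+_M),T(0_M))$, and $(c_M,1_{TM})$ is one from $(T(p_M),T(+_M),T(0_M))$ to $(p_{TM},+_{TM},0_{TM})$; (4) $cc=1$, $\ell c=\ell$, $\ell T(\ell)=\ell\ell_T$, $T(c)c_TT(c)=c_TT(c)c_T$, $\ell_TT(c)c_T=cT(\ell)$; (5) with $v:=\langle\pi_0\ell,\pi_10_{TM}\rangle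 T(+):T_2M\to T^2M$, the square $vT(p)=\pi_0p0$ exhibits $T_2M$ as the pullback of $T(p_M)$ along $0_M$, and this pullback is preserved by every $T^k$. It is Cartesian if it has finite products (terminal object $1$, unique maps to it written $!$) and $T$ preserves them; $T(A\times B)$ is identified with $TA\times TB$. Object subscripts are often omitted. A vector field on $M$ is a map $V:M\to TM$ with $Vp=1_M$. A dynamical system $(M,V,g)$ is a vector field $V$ on $M$ with a map $g:1\to M$. Given a fixed dynamical system $(C,c_1,c_0)$: a parameterized dynamical system (or system) $(M,V,g)$ is a vector field $V:M\to TM$ with a map $g:X\to M$; a solution of it is a map $\gamma:C\times X\to M$ with $\langle !c_0,1\rangle\gamma=g$ and $(c_1\times 0)T(\gamma)=\gamma V$. A curve object is a dynamical system $(C,c_1,c_0)$ such that: (Preinitial) every parameterized dynamical system has at most one solution; (Commutativity of $c_1$) $c_1T(c_1)c=c_1T(c_1)$; (Completeness of $c_1$) the system $(C,c_1,1_C)$ has a solution, denoted $\sigma:C\times C\to C$; $(C,\sigma,c_0)$ is then a commutative monoid. A vector field $V$ on $M$ is complete if every system $(M,V,g)$ has a solution (equivalently, $(M,V,1_M)$ does). A flow on $M$ is a map $\gamma:C\times M\to M$ with $\langle !c_0,1_M\rangle\gamma=1_M$ and $(\sigma\times 1)\gamma=(1\times\gamma)\gamma$. $\mathsf{CVF}(\mathbb{X})$ has objects $(M,V)$ with $V$ a complete vector field on $M$ and maps $f:(M_1,V_1)\to(M_2,V_2)$ the $f:M_1\to M_2$ with $V_1T(f)=fV_2$; it is a Cartesian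 tangent category with $\bar T(M,V)=(TM,T(V)c)$, products $(M_1\times M_2,V_1\times V_2)$, terminal object $(1,0)$, structural transformations as in $\mathbb{X}$, and curve object $((C,0_C),c_1,c_0)$. $\mathsf{FLOW}(\mathbb{X})$ has objects $(M,\gamma)$ with $\gamma$ a flow on $M$ and maps $f:(M_1,\gamma_1)\to(M_2,\gamma_2)$ the $f:M_1\to M_2$ with $\gamma_1f=(1\times f)\gamma_2$; it is a Cartesian tangent category with $\bar T(M,\gamma)=(TM,(0\times1)T(\gamma))$, products $(M_1\times M_2,\langle\langle\pi_0,\pi_1\rangle\gamma_1,\langle\pi_0,\pi_2\rangle\gamma_2\rangle)$, structural transformations as in $\mathbb{X}$, and curve object $((C,\pi_1),c_1,c_0)$. The notation $((M,\gamma_1),\gamma_2)$ denotes a flow $\gamma_2$ on the object $(M,\gamma_1)$ of $\mathsf{FLOW}(\mathbb{X})$, and similarly for $((M,V),\gamma)$. Flows $\gamma_1,\gamma_2$ on $M$ commute if $(\tau\times 1)(1\times\gamma_1)\gamma_2=(1\times\gamma_2)\gamma_1:C\times C\times M\to M$, where $\tau=\langle\pi_1,\pi_0\rangle$. $V$ is invariant under $\gamma$ if $\gamma V=(0\times V)T(\gamma)$. *)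

(* Defs.v *)
From mathcomp Require Import all_boot.
From mathcomp Require Import boolp.

Set Implicit Arguments.
Unset Strict Implicit.
Unset Printing Implicit Defensive.

(* Composition is in diagrammatic order: [f ;; g] is "first f, then g". *)
Reserved Notation "f ;; g" (at level 40, left associativity).

Record category := Category {
  ob :> Type;
  hom : ob -> ob -> Type;
  idm : forall A, hom A A;
  ccomp : forall A B D, hom A B -> hom B D -> hom A D;
  comp1m : forall A B (f : hom A B), ccomp (idm A) f = f;
  compm1 : forall A B (f : hom A B), ccomp f (idm B) = f;
  ccompA : forall A B D E (f : hom A B) (g : hom B D) (h : hom D E),
    ccomp f (ccomp g h) = ccomp (ccomp f g) h }.

Arguments hom {c} A B.
Arguments idm {c} A.
Arguments ccomp {c A B D} f g.

Notation "f ;; g" := (ccomp f g).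

Record functor (X Y : category) := Functor {
  fob :> X -> Y;
  fmap : forall A B, hom A B -> hom (fob A) (fob B);
  fmap1 : forall A, fmap (idm A) = idm (fob A);
  fmapM : forall A B D (f : hom A B) (g : hom B D),
    fmap (f ;; g) = fmap f ;; fmap g }.

Arguments fmap {X Y} F {A B} f : rename.

Definition is_iso (X : category) (A B : X) (f : hom A B) :=
  exists g : hom B A, f ;; g = idm A /\ g ;; f = idm B.

(* A cone over [n] copies of [q : A -> B]; [base] is the common composite with
   [q], which is what makes the case [n = 0] meaningful. *)
Record fcone (X : category) (A B : X) (q : hom A B) (n : nat) := Fcone {
  apex : X;
  base : hom apex B;
  leg : 'I_n -> hom apex A }.

Definition is_fibre_power (X : category) (A B : X) (q : hom A B) n
    (P : fcone q n) :=
  (forall i, leg P i ;; q = base P) /\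
  forall (N : X) (r : hom N B) (f : 'I_n -> hom N A),
    (forall i, f i ;; q = r) ->
    exists! h : hom N (apex P),
      h ;; base P = r /\ forall i, h ;; leg P i = f i.

Definition is_pullback (X : category) (P A B D : X) (u : hom P A)
    (v : hom P B) (f : hom A D) (g : hom B D) :=
  u ;; f = v ;; g /\
  forall (N : X) (a : hom N A) (b : hom N B), a ;; f = b ;; g ->
    exists! h : hom N P, h ;; u = a /\ h ;; v = b.

Definition fcone_image (X Y : category) (F : functor X Y) (A B : X)
    (q : hom A B) n (P : fcone q n) : fcone (fmap F q) n :=
  Fcone (fmap F q) (fmap F (base P)) (fun i => fmap F (leg P i)).

(* "The image under F^k is a fibre power (resp. a pullback)". *)
Fixpoint is_fibre_power_iter (X : category) (F : functor X X) (k : nat)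
    (A B : X) (q : hom A B) n (P : fcone q n) : Prop :=
  if k is k'.+1 then is_fibre_power_iter F k' (fcone_image F P)
  else is_fibre_power P.

Fixpoint is_pullback_iter (X : category) (F : functor X X) (k : nat)
    (P A B D : X) (u : hom P A) (v : hom P B) (f : hom A D) (g : hom B D)
    : Prop :=
  if k is k'.+1 then
    is_pullback_iter F k' (fmap F u) (fmap F v) (fmap F f) (fmap F g)
  else is_pullback u v f g.

(* [h] is the map <a, b> (resp. <a, b, d>) into a fibre power, resp. the map
   f x_g ... x_g f between fibre powers.  These maps exist and are unique
   whenever the target is a fibre power and the components are compatible, so
   that they can be introduced by "for all h such that". *)
Definition is_pair2 (X : category) (A B N : X) (q : hom A B) (P : fcone q 2)
    (h : hom N (apex P)) (a b : hom N A) :=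
  h ;; leg P ord0 = a /\ h ;; leg P ord_max = b.

Definition is_fibre_map (X : category) (A B A' B' : X) (q : hom A B)
    (q' : hom A' B') n (P : fcone q n) (P' : fcone q' n)
    (f : hom A A') (g : hom B B') (h : hom (apex P) (apex P')) :=
  h ;; base P' = base P ;; g /\ forall i, h ;; leg P' i = leg P i ;; f.

Definition o30 : 'I_3 := Ordinal (isT : 0 < 3).
Definition o31 : 'I_3 := Ordinal (isT : 1 < 3).
Definition o32 : 'I_3 := Ordinal (isT : 2 < 3).

(* (q, plus, zero) is a commutative monoid in the slice over [B]. *)
Record additive_bundle (X : category) (A B : X) (q : hom A B)
    (P : forall n, fcone q n) (plus : hom (apex (P 2)) A) (zero : hom B A)
    : Prop := AdditiveBundle {
  bundle_plus : plus ;; q = base (P 2);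
  bundle_zero : zero ;; q = idm B;
  bundle_addA : forall h01 h12 l r : hom (apex (P 3)) (apex (P 2)),
    is_pair2 h01 (leg (P 3) o30) (leg (P 3) o31) ->
    is_pair2 h12 (leg (P 3) o31) (leg (P 3) o32) ->
    is_pair2 l (h01 ;; plus) (leg (P 3) o32) ->
    is_pair2 r (leg (P 3) o30) (h12 ;; plus) ->
    l ;; plus = r ;; plus;
  bundle_addC : forall h : hom (apex (P 2)) (apex (P 2)),
    is_pair2 h (leg (P 2) ord_max) (leg (P 2) ord0) -> h ;; plus = plus;
  bundle_addr0 : forall h : hom A (apex (P 2)),
    is_pair2 h (idm A) (q ;; zero) -> h ;; plus = idm A }.

Record bundle_morphism (X : category) (A B A' B' : X)
    (q : hom A B) (P : fcone q 2) (plus : hom (apex P) A) (zero : hom B A)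
    (q' : hom A' B') (P' : fcone q' 2) (plus' : hom (apex P') A')
    (zero' : hom B' A') (f : hom A A') (g : hom B B')
    : Prop := BundleMorphism {
  bundle_mor_proj : f ;; q' = q ;; g;
  bundle_mor_plus : forall h : hom (apex P) (apex P'),
    is_fibre_map f g h -> plus ;; f = h ;; plus';
  bundle_mor_zero : zero ;; f = g ;; zero' }.

Record tangent_category := TangentCategory {
  tcat :> category;
  tan : functor tcat tcat;
  tproj : forall M, hom (tan M) M;
  tzero : forall M, hom M (tan M);
  tpow : forall M n, fcone (tproj M) n;
  tplus : forall M, hom (apex (tpow M 2)) (tan M);
  tlift : forall M, hom (tan M) (tan (tan M));
  tflip : forall M, hom (tan (tan M)) (tan (tan M));
  tproj_nat : forall M N (f : hom M N), fmap tan f ;; tproj N = tproj M ;; f;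
  tzero_nat : forall M N (f : hom M N), f ;; tzero N = tzero M ;; fmap tan f;
  tplus_nat : forall M N (f : hom M N)
      (h : hom (apex (tpow M 2)) (apex (tpow N 2))),
    is_fibre_map (fmap tan f) f h -> tplus M ;; fmap tan f = h ;; tplus N;
  tlift_nat : forall M N (f : hom M N),
    fmap tan f ;; tlift N = tlift M ;; fmap tan (fmap tan f);
  tflip_nat : forall M N (f : hom M N),
    fmap tan (fmap tan f) ;; tflip N = tflip M ;; fmap tan (fmap tan f);
  tpow_lim : forall M n k, is_fibre_power_iter tan k (tpow M n);
  tadd : forall M, additive_bundle (P := tpow M) (tplus M) (tzero M);
  tlift_bundle : forall M,
    bundle_morphism (tplus M) (tzero M)
      (P' := fcone_image tan (tpow M 2))
      (fmap tan (tplus M)) (fmap tan (tzero M)) (tlift M) (tzero M);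
  tflip_bundle : forall M,
    bundle_morphism (P := fcone_image tan (tpow M 2))
      (fmap tan (tplus M)) (fmap tan (tzero M))
      (tplus (tan M)) (tzero (tan M)) (tflip M) (idm (tan M));
  tflipK : forall M, tflip M ;; tflip M = idm (tan (tan M));
  tlift_flip : forall M, tlift M ;; tflip M = tlift M;
  tlift_lift : forall M,
    tlift M ;; fmap tan (tlift M) = tlift M ;; tlift (tan M);
  tflip_braid : forall M,
    fmap tan (tflip M) ;; tflip (tan M) ;; fmap tan (tflip M) =
    tflip (tan M) ;; fmap tan (tflip M) ;; tflip (tan M);
  tlift_flip_flip : forall M,
    tlift (tan M) ;; fmap tan (tflip M) ;; tflip (tan M) =
    tflip M ;; fmap tan (tlift M);
  (* universality of the vertical lift; [w ;; T(+)] is the map v *)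
  tlift_univ : forall M k
      (w : hom (apex (tpow M 2)) (apex (fcone_image tan (tpow M 2)))),
    is_pair2 (P := fcone_image tan (tpow M 2)) w
      (leg (tpow M 2) ord0 ;; tlift M)
      (leg (tpow M 2) ord_max ;; tzero (tan M)) ->
    is_pullback_iter tan k (w ;; fmap tan (tplus M))
      (leg (tpow M 2) ord0 ;; tproj M) (fmap tan (tproj M)) (tzero M) }.

Arguments tan {t}.
Arguments tproj {t} M.
Arguments tzero {t} M.
Arguments tpow {t} M n.
Arguments tplus {t} M.
Arguments tlift {t} M.
Arguments tflip {t} M.

(* [tprod] is the identification of TA x TB with T(A x B), i.e. the inverse of
   <T(fst), T(snd)>. *)
Record cartesian_tangent_category := CartesianTangentCategory {
  ctcat :> tangent_category;
  one : ctcat;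
  bang : forall A, hom A one;
  bang_uniq : forall A (f : hom A one), f = bang A;
  prd : ctcat -> ctcat -> ctcat;
  pr0 : forall A B, hom (prd A B) A;
  pr1 : forall A B, hom (prd A B) B;
  pairing : forall N A B, hom N A -> hom N B -> hom N (prd A B);
  pair_pr0 : forall N A B (f : hom N A) (g : hom N B),
    pairing f g ;; pr0 A B = f;
  pair_pr1 : forall N A B (f : hom N A) (g : hom N B),
    pairing f g ;; pr1 A B = g;
  pair_uniq : forall N A B (h : hom N (prd A B)),
    h = pairing (h ;; pr0 A B) (h ;; pr1 A B);
  tone_iso : is_iso (bang (tan one));
  tprod : forall A B, hom (prd (tan A) (tan B)) (tan (prd A B));
  tprodK : forall A B, tprod A B ;;
    pairing (fmap tan (pr0 A B)) (fmap tan (pr1 A B)) = idm _;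
  tprodVK : forall A B,
    pairing (fmap tan (pr0 A B)) (fmap tan (pr1 A B)) ;; tprod A B = idm _ }.

Arguments one {c}.
Arguments bang {c} A.
Arguments prd {c} A B.
Arguments pr0 {c A B}.
Arguments pr1 {c A B}.
Arguments pairing {c N A B} f g.
Arguments tprod {c} A B.

Notation "A ** B" := (prd A B) (at level 39, right associativity).

Definition pmap (X : cartesian_tangent_category) (A B A' B' : X)
    (f : hom A A') (g : hom B B') : hom (A ** B) (A' ** B') :=
  pairing (pr0 ;; f) (pr1 ;; g).

Definition assoc (X : cartesian_tangent_category) (A B D : X) :
    hom ((A ** B) ** D) (A ** (B ** D)) :=
  pairing (pr0 ;; pr0) (pairing (pr0 ;; pr1) pr1).

Definition twist (X : cartesian_tangent_category) (A B : X) :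
    hom (A ** B) (B ** A) := pairing pr1 pr0.

Arguments assoc {X} A B D.
Arguments twist {X} A B.

Definition is_vector_field (X : tangent_category) (M : X) (V : hom M (tan M)) :=
  V ;; tproj M = idm M.

Record dynamical_system (X : cartesian_tangent_category) := DynamicalSystem {
  ds_ob :> X;
  ds_vf : hom ds_ob (tan ds_ob);
  ds_pt : hom one ds_ob;
  ds_vfP : is_vector_field ds_vf }.

Arguments ds_vf {X} d.
Arguments ds_pt {X} d.

Definition at_zero (X : cartesian_tangent_category) (C : dynamical_system X)
    (M : X) : hom M (C ** M) := pairing (bang M ;; ds_pt C) (idm M).

Arguments at_zero {X} C M.

(* [gamma] solves the parameterized system (M, V, g). *)
Definition is_solution (X : cartesian_tangent_category) (C : dynamical_system X)
    (M N : X) (V : hom M (tan M)) (g : hom N M) (gamma : hom (C ** N) M) :=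
  at_zero C N ;; gamma = g /\
  pmap (ds_vf C) (tzero N) ;; tprod C N ;; fmap tan gamma = gamma ;; V.

Record curve_object (X : cartesian_tangent_category) := CurveObject {
  co_ds :> dynamical_system X;
  co_preinitial : forall (M N : X) (V : hom M (tan M)) (g : hom N M)
      (gamma gamma' : hom (co_ds ** N) M),
    is_vector_field V -> is_solution V g gamma -> is_solution V g gamma' ->
    gamma = gamma';
  co_comm : ds_vf co_ds ;; fmap tan (ds_vf co_ds) ;; tflip co_ds =
    ds_vf co_ds ;; fmap tan (ds_vf co_ds);
  co_sigma : hom (co_ds ** co_ds) co_ds;
  co_sigmaP : is_solution (ds_vf co_ds) (idm co_ds) co_sigma }.

Arguments co_sigma {X} c.

Definition is_complete (X : cartesian_tangent_category) (C : curve_object X)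
    (M : X) (V : hom M (tan M)) :=
  forall (N : X) (g : hom N M),
    exists gamma : hom (C ** N) M, is_solution V g gamma.

Arguments is_complete {X} C {M} V.

Definition is_flow (X : cartesian_tangent_category) (C : curve_object X) (M : X)
    (gamma : hom (C ** M) M) :=
  at_zero C M ;; gamma = idm M /\
  pmap (co_sigma C) (idm M) ;; gamma =
    assoc C C M ;; pmap (idm C) gamma ;; gamma.

Definition flow (X : cartesian_tangent_category) (C : curve_object X) (M : X) :=
  {gamma : hom (C ** M) M | is_flow gamma}.

Definition flows_commute (X : cartesian_tangent_category) (C : curve_object X)
    (M : X) (g1 g2 : hom (C ** M) M) :=
  pmap (twist C C) (idm M) ;; assoc C C M ;; pmap (idm C) g1 ;; g2 =
  assoc C C M ;; pmap (idm C) g2 ;; g1.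

Definition is_invariant (X : cartesian_tangent_category) (C : curve_object X)
    (M : X) (V : hom M (tan M)) (gamma : hom (C ** M) M) :=
  gamma ;; V = pmap (tzero C) V ;; tprod C M ;; fmap tan gamma.


(* Categories of structured objects.  A [tangent_structure] on X specifies a
   type of structures on each object and which maps preserve them;
   [total_tangent] is the resulting tangent category, in which the functor,
   fibre powers and transformations are those of X, suitably lifted.  CVF(X)
   and FLOW(X) are both obtained in this way. *)
Definition jointly_monic (X : category) (I : Type) (L : X) (B : I -> X)
    (l : forall i, hom L (B i)) :=
  forall (N : X) (h h' : hom N L), (forall i, h ;; l i = h' ;; l i) -> h = h'.

Record tangent_structure (X : tangent_category) := TangentStructure {
  str :> X -> Type;
  strhom : forall M N, str M -> str N -> hom M N -> Prop;
  strhom1 : forall M (s : str M), strhom s s (idm M);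
  strhomM : forall M N P (s : str M) (t : str N) (u : str P)
      (f : hom M N) (g : hom N P),
    strhom s t f -> strhom t u g -> strhom s u (f ;; g);
  str_tan : forall M, str M -> str (tan M);
  strhom_tan : forall M N (s : str M) (t : str N) (f : hom M N),
    strhom s t f -> strhom (str_tan s) (str_tan t) (fmap tan f);
  strhom_proj : forall M (s : str M), strhom (str_tan s) s (tproj M);
  strhom_zero : forall M (s : str M), strhom s (str_tan s) (tzero M);
  strhom_lift : forall M (s : str M),
    strhom (str_tan s) (str_tan (str_tan s)) (tlift M);
  strhom_flip : forall M (s : str M),
    strhom (str_tan (str_tan s)) (str_tan (str_tan s)) (tflip M);
  str_pow : forall M n, str M -> str (apex (tpow M n));
  strhom_base : forall M n (s : str M),
    strhom (str_pow n s) s (base (tpow M n));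
  strhom_leg : forall M n (s : str M) i,
    strhom (str_pow n s) (str_tan s) (leg (tpow M n) i);
  strhom_plus : forall M (s : str M),
    strhom (str_pow 2 s) (str_tan s) (tplus M);
  str_reflect : forall (I : Type) (L : X) (B : I -> X) (s : str L)
      (t : forall i, str (B i)) (l : forall i, hom L (B i)),
    jointly_monic l -> jointly_monic (fun i => fmap tan (l i)) ->
    (forall i, strhom s (t i) (l i)) ->
    forall (N : X) (r : str N) (h : hom N L),
      (forall i, strhom r (t i) (h ;; l i)) -> strhom r s h }.

Record cartesian_structure (X : cartesian_tangent_category) :=
  CartesianStructure {
  cstr :> tangent_structure X;
  str_one : cstr one;
  str_prd : forall M N, cstr M -> cstr N -> cstr (M ** N);
  strhom_bang : forall M (s : cstr M), strhom s str_one (bang M);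
  strhom_pr0 : forall M N (s : cstr M) (t : cstr N),
    strhom (str_prd s t) s pr0;
  strhom_pr1 : forall M N (s : cstr M) (t : cstr N),
    strhom (str_prd s t) t pr1 }.

Lemma sval_inj (A : Type) (P : A -> Prop) (x y : {a | P a}) :
  sval x = sval y -> x = y.
Proof.
case: x y => [x px] [y py] /= e; move: px py; rewrite e => px py.
by rewrite (Prop_irrelevance px py).
Qed.

Section ConeLemmas.
Variables (X : tangent_category).

Definition fcone_legs (A B : X) (q : hom A B) n (P : fcone q n)
    (i : option 'I_n) : hom (apex P) (if i is Some _ then A else B) :=
  match i with Some j => leg P j | None => base P end.

Lemma fibre_power_monic (A B : X) (q : hom A B) n (P : fcone q n) :
  is_fibre_power P -> jointly_monic (fcone_legs P).
Proof.
move=> [Pq Pu] N h h' e.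
have [|k [_ ku]] := Pu N (h ;; base P) (fun i => h ;; leg P i).
  by move=> i; rewrite -ccompA Pq.
rewrite -(ku h) // -(ku h') //; split; first exact: (esym (e None)).
by move=> i; exact: (esym (e (Some i))).
Qed.

Lemma fibre_power_inj (A B : X) (q : hom A B) n (P : fcone q n) :
  is_fibre_power P -> forall N (h h' : hom N (apex P)),
  h ;; base P = h' ;; base P -> (forall i, h ;; leg P i = h' ;; leg P i) ->
  h = h'.
Proof. by move=> Pl N h h' e0 e; apply: (fibre_power_monic Pl) => -[i|] /=. Qed.

Lemma fibre_power_image_monic (A B : X) (q : hom A B) n (P : fcone q n) :
  is_fibre_power (fcone_image tan P) ->
  jointly_monic (fun i => fmap tan (fcone_legs P i)).
Proof.
move=> Pl N h h' e; apply: (fibre_power_inj Pl) => [|i].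
  exact: (e None).
exact: (e (Some i)).
Qed.

Lemma fibre_power_ex (A B : X) (q : hom A B) n (P : fcone q n) :
  is_fibre_power P -> forall (N : X) (r : hom N B) (f : 'I_n -> hom N A),
    (forall i, f i ;; q = r) ->
    {h : hom N (apex P) | h ;; base P = r /\ forall i, h ;; leg P i = f i}.
Proof.
move=> [_ Pu] N r f e; apply: cid.
by have [h [? _]] := Pu N r f e; exists h.
Qed.

Definition pb_legs (P A B : X) (u : hom P A) (v : hom P B) (i : bool) :
  hom P (if i then A else B) := if i as i return hom P (if i then A else B)
                                then u else v.

Lemma pullback_monic (P A B D : X) (u : hom P A) (v : hom P B) (f : hom A D)
    (g : hom B D) : is_pullback u v f g -> jointly_monic (pb_legs u v).
Proof.
move=> [e Pu] N h h' eh.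
have [|k [_ ku]] := Pu N (h ;; u) (h ;; v); first by rewrite -!ccompA e.
rewrite -(ku h) // -(ku h') //; split; first exact: (esym (eh true)).
exact: (esym (eh false)).
Qed.

Lemma pullback_image_monic (P A B D : X) (u : hom P A) (v : hom P B)
    (f : hom A D) (g : hom B D) :
  is_pullback (fmap tan u) (fmap tan v) (fmap tan f) (fmap tan g) ->
  jointly_monic (fun i => fmap tan (pb_legs u v i)).
Proof.
move=> Pl N h h' e; apply: (pullback_monic Pl) => -[]; [exact: (e true)|].
exact: (e false).
Qed.

End ConeLemmas.

Section Total.
Variables (X : tangent_category) (S : tangent_structure X).

Definition total_ob : Type := {M : X & S M}.
Definition total_hom (A B : total_ob) : Type :=
  {f : hom (projT1 A) (projT1 B) | strhom (projT2 A) (projT2 B) f}.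

Program Definition total_cat : category :=
  @Category total_ob total_hom
    (fun A => exist _ (idm (projT1 A)) (strhom1 _))
    (fun A B D f g => exist _ (sval f ;; sval g) (strhomM (svalP f) (svalP g)))
    _ _ _.
Next Obligation. by apply: sval_inj; exact: comp1m. Qed.
Next Obligation. by apply: sval_inj; exact: compm1. Qed.
Next Obligation. by apply: sval_inj; exact: ccompA. Qed.

Definition total_tan_ob (A : total_ob) : total_ob :=
  existT _ (tan (projT1 A)) (str_tan (projT2 A)).

Program Definition total_tan : functor total_cat total_cat :=
  @Functor total_cat total_cat total_tan_ob
    (fun A B f => exist _ (fmap tan (sval f)) (strhom_tan (svalP f)))
    _ _.
Next Obligation. by apply: sval_inj; exact: fmap1. Qed.
Next Obligation. by apply: sval_inj; exact: fmapM. Qed.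

Definition total_proj (A : total_cat) : hom (total_tan A) A :=
  exist _ (tproj (projT1 A)) (strhom_proj (projT2 A)).
Definition total_zero (A : total_cat) : hom A (total_tan A) :=
  exist _ (tzero (projT1 A)) (strhom_zero (projT2 A)).
Definition total_lift (A : total_cat) :
    hom (total_tan A) (total_tan (total_tan A)) :=
  exist _ (tlift (projT1 A)) (strhom_lift (projT2 A)).
Definition total_flip (A : total_cat) :
    hom (total_tan (total_tan A)) (total_tan (total_tan A)) :=
  exist _ (tflip (projT1 A)) (strhom_flip (projT2 A)).

Definition total_pow (A : total_cat) n : fcone (total_proj A) n :=
  @Fcone total_cat _ _ (total_proj A) n
    (existT _ (apex (tpow (projT1 A) n)) (str_pow n (projT2 A)))
    (exist _ (base (tpow (projT1 A) n)) (strhom_base n (projT2 A)))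
    (fun i => exist _ (leg (tpow (projT1 A) n) i) (strhom_leg (projT2 A) i)).

Definition total_plus (A : total_cat) :
    hom (apex (total_pow A 2)) (total_tan A) :=
  exist _ (tplus (projT1 A)) (strhom_plus (projT2 A)).

Definition under_cone (A B : total_cat) (q : hom A B) n (P : fcone q n) :
    fcone (sval q) n :=
  Fcone (sval q) (sval (base P)) (fun i => sval (leg P i)).

Lemma under_total_pow (A : total_cat) n :
  under_cone (total_pow A n) = tpow (projT1 A) n.
Proof. by rewrite /under_cone /=; case: (tpow _ _). Qed.

Lemma total_fibre_power (A B : total_cat) (q : hom A B) n (P : fcone q n) :
  is_fibre_power (under_cone P) ->
  is_fibre_power (fcone_image tan (under_cone P)) -> is_fibre_power P.
Proof.
move=> P0 P1; split=> [i|N r f e].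
  by apply: sval_inj; exact: (P0.1 i).
have [|h [[hr hf] hu]] := P0.2 _ (sval r) (fun i => sval (f i)).
  by move=> i; have := congr1 sval (e i).
have hS : strhom (projT2 N) (projT2 (apex P)) h.
  pose t (i : option 'I_n) :=
    match i return S (if i is Some _ then projT1 A else projT1 B) with
    | Some _ => projT2 A | None => projT2 B end.
  apply: (str_reflect (t := t) (fibre_power_monic P0)
           (fibre_power_image_monic P1)) => -[i|] /=.
  - exact: svalP (leg P i).
  - exact: svalP (base P).
  - by rewrite hf; exact: svalP (f i).
  - by rewrite hr; exact: svalP r.
exists (exist _ h hS); split.
  by split=> [|i]; apply: sval_inj; [exact: hr|exact: hf].
move=> k [kr kf]; apply: sval_inj; apply: hu; split.
  by have := congr1 sval kr.
by move=> i; have := congr1 sval (kf i).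
Qed.

Lemma total_fibre_power_iter k (A B : total_cat) (q : hom A B) n
    (P : fcone q n) :
  (forall j, is_fibre_power_iter tan j (under_cone P)) ->
  is_fibre_power_iter total_tan k P.
Proof.
elim: k A B q P => [|k IH] A B q P H /=.
  by apply: total_fibre_power; [exact: (H 0)|exact: (H 1)].
by apply: IH => j; exact: (H j.+1).
Qed.

Lemma total_pullback (P A B D : total_cat) (u : hom P A) (v : hom P B)
    (f : hom A D) (g : hom B D) :
  is_pullback (sval u) (sval v) (sval f) (sval g) ->
  is_pullback (fmap tan (sval u)) (fmap tan (sval v))
    (fmap tan (sval f)) (fmap tan (sval g)) ->
  is_pullback u v f g.
Proof.
move=> P0 P1; split=> [|N a b e].
  by apply: sval_inj; exact: P0.1.
have [|h [[ha hb] hu]] := P0.2 _ (sval a) (sval b).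
  by have := congr1 sval e.
have hS : strhom (projT2 N) (projT2 P) h.
  pose t (i : bool) :=
    match i return S (if i then projT1 A else projT1 B) with
    | true => projT2 A | false => projT2 B end.
  apply: (str_reflect (t := t) (pullback_monic P0)
           (pullback_image_monic P1)) => -[] /=.
  - exact: svalP u.
  - exact: svalP v.
  - by rewrite ha; exact: svalP a.
  - by rewrite hb; exact: svalP b.
exists (exist _ h hS); split.
  by split; apply: sval_inj; [exact: ha|exact: hb].
move=> k [ka kb]; apply: sval_inj; apply: hu; split.
  by have := congr1 sval ka.
by have := congr1 sval kb.
Qed.

Lemma total_pullback_iter k (P A B D : total_cat) (u : hom P A) (v : hom P B)
    (f : hom A D) (g : hom B D) :
  (forall j, is_pullback_iter tan j (sval u) (sval v) (sval f) (sval g)) ->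
  is_pullback_iter total_tan k u v f g.
Proof.
elim: k P A B D u v f g => [|k IH] P A B D u v f g H /=.
  by apply: total_pullback; [exact: (H 0)|exact: (H 1)].
by apply: IH => j; exact: (H j.+1).
Qed.

Lemma under_pair2 (A B N : total_cat) (q : hom A B) (P : fcone q 2)
    (h : hom N (apex P)) (a b : hom N A) :
  is_pair2 h a b -> is_pair2 (P := under_cone P) (sval h) (sval a) (sval b).
Proof. by case=> h0 h1; split; [rewrite -h0|rewrite -h1]. Qed.

Lemma under_fibre_map (A B A' B' : total_cat) (q : hom A B)
    (q' : hom A' B') n (P : fcone q n) (P' : fcone q' n)
    (f : hom A A') (g : hom B B') (h : hom (apex P) (apex P')) :
  is_fibre_map f g h ->
  is_fibre_map (P := under_cone P) (P' := under_cone P')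
    (sval f) (sval g) (sval h).
Proof.
case=> h0 h1; split; first by have := congr1 sval h0.
by move=> i; have := congr1 sval (h1 i).
Qed.

Lemma total_add (A : total_cat) :
  additive_bundle (P := total_pow A) (total_plus A) (total_zero A).
Proof.
have [a b c d e] := tadd (projT1 A); split.
- by apply: sval_inj; exact: a.
- by apply: sval_inj; exact: b.
- move=> h01 h12 l r p1 p2 p3 p4; apply: sval_inj.
  by apply: c; [exact: under_pair2 p1|exact: under_pair2 p2|
    exact: under_pair2 p3|exact: under_pair2 p4].
- by move=> h ph; apply: sval_inj; apply: d; exact: under_pair2 ph.
- by move=> h ph; apply: sval_inj; apply: e; exact: under_pair2 ph.
Qed.

Definition total_tangent : tangent_category.
Proof.
refine (@TangentCategory total_cat total_tan total_proj total_zero total_pow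
  total_plus total_lift total_flip _ _ _ _ _ _ total_add _ _ _ _ _ _ _ _).
- by move=> M N f; apply: sval_inj; exact: tproj_nat.
- by move=> M N f; apply: sval_inj; exact: tzero_nat.
- move=> M N f h hh; apply: sval_inj; apply: tplus_nat.
  exact: (under_fibre_map hh).
- by move=> M N f; apply: sval_inj; exact: tlift_nat.
- by move=> M N f; apply: sval_inj; exact: tflip_nat.
- move=> M n k; apply: total_fibre_power_iter => j.
  by rewrite under_total_pow; exact: tpow_lim.
- move=> M; have [a b c] := tlift_bundle (projT1 M); split.
  + by apply: sval_inj.
  + by move=> h hh; apply: sval_inj; apply: b; exact: (under_fibre_map hh).
  + by apply: sval_inj.
- move=> M; have [a b c] := tflip_bundle (projT1 M); split.
  + by apply: sval_inj.
  + by move=> h hh; apply: sval_inj; apply: b; exact: (under_fibre_map hh).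
  + by apply: sval_inj.
- by move=> M; apply: sval_inj; exact: tflipK.
- by move=> M; apply: sval_inj; exact: tlift_flip.
- by move=> M; apply: sval_inj; exact: tlift_lift.
- by move=> M; apply: sval_inj; exact: tflip_braid.
- by move=> M; apply: sval_inj; exact: tlift_flip_flip.
- move=> M k w hw; apply: total_pullback_iter => j.
  exact: (tlift_univ j (under_pair2 hw)).
Defined.

End Total.

Arguments total_tan {X} S.
Arguments total_zero {X} S A.

Section CartesianLemmas.
Variables (X : cartesian_tangent_category).
Implicit Types A B D M N : X.

Lemma bang_eq N (f g : hom N one) : f = g.
Proof. by rewrite (bang_uniq f) (bang_uniq g). Qed.

Lemma comp_bang N A (f : hom N A) : f ;; bang A = bang N.
Proof. exact: bang_eq. Qed.

Lemma pair_ext N A B (h h' : hom N (A ** B)) :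
  h ;; pr0 = h' ;; pr0 -> h ;; pr1 = h' ;; pr1 -> h = h'.
Proof. by move=> e0 e1; rewrite (pair_uniq h) (pair_uniq h') e0 e1. Qed.

Lemma comp_pair P N A B (k : hom P N) (f : hom N A) (g : hom N B) :
  k ;; pairing f g = pairing (k ;; f) (k ;; g).
Proof. by apply: pair_ext; rewrite -ccompA ?pair_pr0 ?pair_pr1. Qed.

Lemma pair_pr0A N A B D (f : hom N A) (g : hom N B) (k : hom A D) :
  pairing f g ;; (pr0 ;; k) = f ;; k.
Proof. by rewrite ccompA pair_pr0. Qed.

Lemma pair_pr1A N A B D (f : hom N A) (g : hom N B) (k : hom B D) :
  pairing f g ;; (pr1 ;; k) = g ;; k.
Proof. by rewrite ccompA pair_pr1. Qed.

Lemma tone_eq N (f g : hom N (tan one)) : f = g.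
Proof.
have [k [e _]] := tone_iso X.
by rewrite -(compm1 f) -(compm1 g) -e !ccompA; congr (_ ;; _); exact: bang_eq.
Qed.

Lemma tprod_pr0 A B : tprod A B ;; fmap tan pr0 = pr0.
Proof.
by rewrite -[RHS]comp1m -(tprodK A B) -ccompA pair_pr0.
Qed.

Lemma tprod_pr1 A B : tprod A B ;; fmap tan pr1 = pr1.
Proof.
by rewrite -[RHS]comp1m -(tprodK A B) -ccompA pair_pr1.
Qed.

Lemma tprod_pr0A A B D (k : hom (tan A) D) :
  tprod A B ;; (fmap tan pr0 ;; k) = pr0 ;; k.
Proof. by rewrite ccompA tprod_pr0. Qed.

Lemma tprod_pr1A A B D (k : hom (tan B) D) :
  tprod A B ;; (fmap tan pr1 ;; k) = pr1 ;; k.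
Proof. by rewrite ccompA tprod_pr1. Qed.

Lemma tan_ext N A B (h h' : hom N (tan (A ** B))) :
  h ;; fmap tan pr0 = h' ;; fmap tan pr0 ->
  h ;; fmap tan pr1 = h' ;; fmap tan pr1 -> h = h'.
Proof.
move=> e0 e1; rewrite -(compm1 h) -(compm1 h') -(tprodVK A B) !ccompA.
by congr (_ ;; _); rewrite !comp_pair e0 e1.
Qed.

Lemma tan2_ext N A B (h h' : hom N (tan (tan (A ** B)))) :
  h ;; fmap tan (fmap tan pr0) = h' ;; fmap tan (fmap tan pr0) ->
  h ;; fmap tan (fmap tan pr1) = h' ;; fmap tan (fmap tan pr1) -> h = h'.
Proof.
move=> e0 e1; rewrite -(compm1 h) -(compm1 h') -(fmap1 tan (tan (A ** B))).
rewrite -(tprodVK A B).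
rewrite fmapM !ccompA; congr (_ ;; _).
by apply: tan_ext; rewrite -!ccompA -!fmapM ?pair_pr0 ?pair_pr1.
Qed.

Lemma fmapMA (F : functor X X) A B D (E : X) (f : hom A B) (g : hom B D)
   (k : hom (F D) E) :
  fmap F f ;; (fmap F g ;; k) = fmap F (f ;; g) ;; k.
Proof. by rewrite fmapM ccompA. Qed.

Lemma tprod_nat A B A' B' (f : hom A A') (g : hom B B') :
  tprod A B ;; fmap tan (pmap f g) =
  pmap (fmap tan f) (fmap tan g) ;; tprod A' B'.
Proof.
apply: tan_ext; rewrite -!ccompA -!fmapM ?pair_pr0 ?pair_pr1 !fmapM
  ?tprod_pr0 ?tprod_pr1 ?tprod_pr0A ?tprod_pr1A /pmap ?pair_pr0 ?pair_pr1 //.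
Qed.

Definition prd_legs A B (i : bool) : hom (A ** B) (if i then A else B) :=
  if i as i return hom (A ** B) (if i then A else B) then pr0 else pr1.

Lemma prd_legs_monic A B : jointly_monic (@prd_legs A B).
Proof.
by move=> N h h' e; apply: pair_ext; [exact: (e true)|exact: (e false)].
Qed.

Lemma tan_prd_legs_monic A B :
  jointly_monic (fun i => fmap tan (@prd_legs A B i)).
Proof.
by move=> N h h' e; apply: tan_ext; [exact: (e true)|exact: (e false)].
Qed.

Lemma tan2_prd_legs_monic A B :
  jointly_monic (fun i => fmap tan (fmap tan (@prd_legs A B i))).
Proof.
by move=> N h h' e; apply: tan2_ext; [exact: (e true)|exact: (e false)].
Qed.

End CartesianLemmas.

Section CartesianTotal.
Variables (X : cartesian_tangent_category) (S : cartesian_structure X).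

Definition total_one : total_tangent S := existT _ one (str_one S).
Definition total_bang (A : total_tangent S) : hom A total_one :=
  exist _ (bang (projT1 A)) (strhom_bang (projT2 A)).
Definition total_prd (A B : total_tangent S) : total_tangent S :=
  existT _ (projT1 A ** projT1 B) (str_prd (projT2 A) (projT2 B)).
Definition total_pr0 (A B : total_tangent S) : hom (total_prd A B) A :=
  exist _ pr0 (strhom_pr0 (projT2 A) (projT2 B)).
Definition total_pr1 (A B : total_tangent S) : hom (total_prd A B) B :=
  exist _ pr1 (strhom_pr1 (projT2 A) (projT2 B)).

Lemma strhom_pair (N A B : total_tangent S) (f : hom N A) (g : hom N B) :
  strhom (projT2 N) (projT2 (total_prd A B)) (pairing (sval f) (sval g)).
Proof.
pose t (i : bool) := match i return S (if i then projT1 A else projT1 B) with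
    | true => projT2 A | false => projT2 B end.
apply: (str_reflect (t := t) (@prd_legs_monic _ _ _)
         (@tan_prd_legs_monic _ _ _)) => -[] /=.
- exact: strhom_pr0.
- exact: strhom_pr1.
- by rewrite pair_pr0; exact: svalP f.
- by rewrite pair_pr1; exact: svalP g.
Qed.

Lemma strhom_tprod (A B : total_tangent S) :
  strhom (projT2 (total_prd (total_tan S A) (total_tan S B)))
    (projT2 (total_tan S (total_prd A B))) (tprod (projT1 A) (projT1 B)).
Proof.
pose t (i : bool) :=
  match i return S (tan (if i then projT1 A else projT1 B)) with
    | true => str_tan (projT2 A) | false => str_tan (projT2 B) end.
apply: (str_reflect (t := t) (@tan_prd_legs_monic _ _ _)
         (@tan2_prd_legs_monic _ _ _)) => -[] /=.
- by apply: strhom_tan; exact: strhom_pr0.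
- by apply: strhom_tan; exact: strhom_pr1.
- by rewrite tprod_pr0; exact: strhom_pr0.
- by rewrite tprod_pr1; exact: strhom_pr1.
Qed.

Definition total_pair (N A B : total_tangent S) (f : hom N A) (g : hom N B) :
    hom N (total_prd A B) :=
  exist _ (pairing (sval f) (sval g)) (strhom_pair f g).

Definition total_tprod (A B : total_tangent S) :
    hom (total_prd (total_tan S A) (total_tan S B))
      (total_tan S (total_prd A B)) :=
  exist _ (tprod (projT1 A) (projT1 B)) (strhom_tprod A B).

Definition total_cartesian : cartesian_tangent_category.
Proof.
refine (@CartesianTangentCategory (total_tangent S) total_one total_bang _
  total_prd total_pr0 total_pr1 total_pair _ _ _ _ total_tprod _ _).
- by move=> A f; apply: sval_inj; exact: bang_uniq.
- by move=> N A B f g; apply: sval_inj; exact: pair_pr0.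
- by move=> N A B f g; apply: sval_inj; exact: pair_pr1.
- by move=> N A B h; apply: sval_inj; exact: pair_uniq.
- exists (total_zero S total_one); split; apply: sval_inj;
    [exact: tone_eq|exact: bang_eq].
- by move=> A B; apply: sval_inj; exact: tprodK.
- by move=> A B; apply: sval_inj; exact: tprodVK.
Defined.

End CartesianTotal.

Section NormalForms.
Variables (X : cartesian_tangent_category).
Implicit Types A B D M N : X.

Lemma tzero_natA M N P (f : hom M N) (k : hom (tan N) P) :
  tzero M ;; (fmap tan f ;; k) = f ;; (tzero N ;; k).
Proof. by rewrite !ccompA tzero_nat. Qed.

Lemma fpair0 N A B (f : hom N A) (g : hom N B) :
  fmap tan (pairing f g) ;; fmap tan pr0 = fmap tan f.
Proof. by rewrite -fmapM pair_pr0. Qed.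

Lemma fpair1 N A B (f : hom N A) (g : hom N B) :
  fmap tan (pairing f g) ;; fmap tan pr1 = fmap tan g.
Proof. by rewrite -fmapM pair_pr1. Qed.

Lemma fpair0A N A B D (f : hom N A) (g : hom N B) (k : hom (tan A) D) :
  fmap tan (pairing f g) ;; (fmap tan pr0 ;; k) = fmap tan f ;; k.
Proof. by rewrite ccompA fpair0. Qed.

Lemma fpair1A N A B D (f : hom N A) (g : hom N B) (k : hom (tan B) D) :
  fmap tan (pairing f g) ;; (fmap tan pr1 ;; k) = fmap tan g ;; k.
Proof. by rewrite ccompA fpair1. Qed.

Lemma ffpair0 N A B (f : hom N A) (g : hom N B) :
  fmap tan (fmap tan (pairing f g)) ;; fmap tan (fmap tan pr0) =
  fmap tan (fmap tan f).
Proof. by rewrite -fmapM fpair0. Qed.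

Lemma ffpair1 N A B (f : hom N A) (g : hom N B) :
  fmap tan (fmap tan (pairing f g)) ;; fmap tan (fmap tan pr1) =
  fmap tan (fmap tan g).
Proof. by rewrite -fmapM fpair1. Qed.

Lemma ftprod0 A B :
  fmap tan (tprod A B) ;; fmap tan (fmap tan pr0) = fmap tan pr0.
Proof. by rewrite -fmapM tprod_pr0. Qed.

Lemma ftprod1 A B :
  fmap tan (tprod A B) ;; fmap tan (fmap tan pr1) = fmap tan pr1.
Proof. by rewrite -fmapM tprod_pr1. Qed.

Lemma fcomp_bang N : tzero N ;; fmap tan (bang N) = bang N ;; tzero one.
Proof. by rewrite tzero_nat. Qed.

Lemma comp_pairA P N A B D (k : hom P N) (f : hom N A) (g : hom N B)
    (m : hom (A ** B) D) :
  k ;; (pairing f g ;; m) = pairing (k ;; f) (k ;; g) ;; m.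
Proof. by rewrite ccompA comp_pair. Qed.

Lemma comp_bangA N A D (f : hom N A) (k : hom one D) :
  f ;; (bang A ;; k) = bang N ;; k.
Proof. by rewrite ccompA comp_bang. Qed.

Definition cartE := (fmapM, fmap1, comp_pair, comp_pairA, pair_pr0, pair_pr1,
  pair_pr0A, pair_pr1A, comp1m, compm1, comp_bangA, tprod_pr0, tprod_pr1,
  tprod_pr0A, tprod_pr1A, fpair0, fpair1, fpair0A, fpair1A).

End NormalForms.

Ltac cart := rewrite /pmap /assoc /twist /at_zero;
  repeat progress (rewrite -?ccompA; rewrite ?cartE).

Section FlowStructure.
Variables (X : cartesian_tangent_category) (C : curve_object X).
Implicit Types M N : X.

Definition flow_preserved M N (g1 : hom (C ** M) M) (g2 : hom (C ** N) N)
    (f : hom M N) := g1 ;; f = pmap (idm C) f ;; g2.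

Definition tan_flow_map M (g : hom (C ** M) M) : hom (C ** tan M) (tan M) :=
  pmap (tzero C) (idm (tan M)) ;; tprod C M ;; fmap tan g.

Definition prd_flow_map M N (g1 : hom (C ** M) M) (g2 : hom (C ** N) N) :
    hom (C ** (M ** N)) (M ** N) :=
  pairing (pmap (idm C) pr0 ;; g1) (pmap (idm C) pr1 ;; g2).

Lemma jointly_monic_flow (I : Type) (L : X) (B : I -> X)
    (l : forall i, hom L (B i)) (g : hom (C ** L) L)
    (gB : forall i, hom (C ** B i) (B i)) :
  jointly_monic l -> (forall i, is_flow (gB i)) ->
  (forall i, flow_preserved g (gB i) (l i)) -> is_flow g.
Proof.
move=> ml fB e; split; apply: ml => i.
  rewrite -ccompA e comp1m -[RHS]compm1 -(fB i).1; by cart.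
transitivity (pmap (idm (C ** C)) (l i) ;;
   (pmap (co_sigma C) (idm (B i)) ;; gB i)).
  by rewrite -ccompA e; cart.
rewrite (fB i).2 -[RHS]ccompA e.
transitivity (assoc C C L ;; pmap (idm C) (g ;; l i) ;; gB i); last by cart.
by rewrite e; cart.
Qed.

Lemma tan_flow_proj M (g : hom (C ** M) M) :
  flow_preserved (tan_flow_map g) g (tproj M).
Proof.
rewrite /flow_preserved /tan_flow_map -ccompA tproj_nat ccompA; congr (_ ;; _).
have p0 := bundle_zero (tadd (C : X)).
apply: pair_ext.
  rewrite -ccompA -tproj_nat; cart; rewrite p0; by cart.
by rewrite -ccompA -tproj_nat; cart.
Qed.

Lemma tan_flow_map_flow M (g : hom (C ** M) M) :
  is_flow g -> is_flow (tan_flow_map g).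
Proof.
case=> g0 gA; split.
  transitivity (fmap tan (at_zero C M) ;; fmap tan g); last first.
    by rewrite -fmapM g0 fmap1.
  rewrite /tan_flow_map !ccompA; congr (_ ;; _).
  apply: tan_ext; cart => //.
  by rewrite tzero_nat ccompA; congr (_ ;; _); exact: tone_eq.
pose k := pmap (tzero (C ** C)) (idm (tan M)) ;; tprod (C ** C) M.
transitivity (k ;; fmap tan (pmap (co_sigma C) (idm M) ;; g)).
  rewrite /k /tan_flow_map fmapM !ccompA; congr (_ ;; _).
  by apply: tan_ext; cart; rewrite ?tzero_nat.
rewrite gA /k {2}/tan_flow_map fmapM !ccompA; congr (_ ;; _).
apply: tan_ext; cart; rewrite -?tzero_nat //.
rewrite /tan_flow_map; cart.
rewrite !ccompA; congr (_ ;; _); apply: tan_ext; cart; rewrite -?tzero_nat //.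
Qed.


Lemma lift_zero M : tzero M ;; tlift M = tzero M ;; tzero (tan M).
Proof. by rewrite (bundle_mor_zero (tlift_bundle M)) tzero_nat. Qed.

Lemma zero_flip M : fmap tan (tzero M) ;; tflip M = tzero (tan M).
Proof. by rewrite (bundle_mor_zero (tflip_bundle M)) comp1m. Qed.

Lemma tan_flow_zero M (g : hom (C ** M) M) :
  flow_preserved g (tan_flow_map g) (tzero M).
Proof.
rewrite /flow_preserved /tan_flow_map tzero_nat !ccompA; congr (_ ;; _).
by apply: tan_ext; cart; rewrite -tzero_nat.
Qed.

Lemma tan_flow_lift M (g : hom (C ** M) M) :
  flow_preserved (tan_flow_map g) (tan_flow_map (tan_flow_map g)) (tlift M).
Proof.
rewrite /flow_preserved {1}/tan_flow_map -ccompA tlift_nat.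
rewrite [in RHS]/tan_flow_map /tan_flow_map !fmapM !ccompA; congr (_ ;; _).
apply: tan2_ext.
  transitivity (@pr0 X C (tan M) ;; tzero C ;; tlift C).
    by rewrite -!ccompA -tlift_nat; cart.
  rewrite -!ccompA ftprod0; cart; by rewrite lift_zero tzero_nat.
transitivity (@pr1 X C (tan M) ;; tlift M).
  by rewrite -!ccompA -tlift_nat; cart.
by rewrite -!ccompA ftprod1; cart.
Qed.

Lemma tan_flow_flip M (g : hom (C ** M) M) :
  flow_preserved (tan_flow_map (tan_flow_map g))
    (tan_flow_map (tan_flow_map g)) (tflip M).
Proof.
rewrite /flow_preserved /tan_flow_map !fmapM -!ccompA tflip_nat !ccompA.
congr (_ ;; _); apply: tan2_ext.
  rewrite -!ccompA -tflip_nat ftprod0 [fmap tan (tprod _ _) ;; _]ccompA ftprod0.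
  by cart; rewrite zero_flip tzero_nat.
rewrite -!ccompA -tflip_nat ftprod1 [fmap tan (tprod _ _) ;; _]ccompA ftprod1.
by cart.
Qed.

Lemma tan_flow_map_preserved M N (g1 : hom (C ** M) M) (g2 : hom (C ** N) N)
    (f : hom M N) :
  flow_preserved g1 g2 f ->
  flow_preserved (tan_flow_map g1) (tan_flow_map g2) (fmap tan f).
Proof.
move=> e; rewrite /flow_preserved /tan_flow_map -ccompA -fmapM e fmapM !ccompA.
by congr (_ ;; _); apply: tan_ext; cart.
Qed.

Lemma pow_flow_ex M n (g : hom (C ** M) M) :
  {h : hom (C ** apex (tpow M n)) (apex (tpow M n)) |
    flow_preserved h g (base (tpow M n)) /\
    forall i, flow_preserved h (tan_flow_map g) (leg (tpow M n) i)}.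
Proof.
have L := tpow_lim M n 0; apply: (fibre_power_ex L) => i.
rewrite -ccompA tan_flow_proj -(L.1 i); by cart.
Qed.

Definition pow_flow_map M n (g : hom (C ** M) M) := sval (pow_flow_ex n g).

Lemma pow_flow_base M n (g : hom (C ** M) M) :
  flow_preserved (pow_flow_map n g) g (base (tpow M n)).
Proof. exact: (svalP (pow_flow_ex n g)).1. Qed.

Lemma pow_flow_leg M n (g : hom (C ** M) M) i :
  flow_preserved (pow_flow_map n g) (tan_flow_map g) (leg (tpow M n) i).
Proof. exact: (svalP (pow_flow_ex n g)).2. Qed.

Lemma pow_flow_map_flow M n (g : hom (C ** M) M) :
  is_flow g -> is_flow (pow_flow_map n g).
Proof.
move=> fg; pose gB (i : option 'I_n) :=
  match i return hom (C ** (if i is Some _ then tan M else M))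
                     (if i is Some _ then tan M else M) with
  | Some _ => tan_flow_map g | None => g end.
apply: (jointly_monic_flow (gB := gB) (fibre_power_monic (tpow_lim M n 0))).
  by move=> [i|] //=; exact: tan_flow_map_flow.
by move=> [i|] /=; [exact: pow_flow_leg|exact: pow_flow_base].
Qed.

Lemma plus_zero_zero N M (a : hom N M) (h : hom N (apex (tpow M 2))) :
  h ;; leg (tpow M 2) ord0 = a ;; tzero M ->
  h ;; leg (tpow M 2) ord_max = a ;; tzero M -> h ;; tplus M = a ;; tzero M.
Proof.
move=> h0 h1; have L := tpow_lim M 2 0.
have p0 := bundle_zero (tadd M).
pose f (i : 'I_2) := if i == ord0 then idm (tan M) else tproj M ;; tzero M.
have [|k [kb kl]] := fibre_power_ex L (r := tproj M) (f := f).
  move=> i; rewrite /f; case: eqP => _; first exact: comp1m.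
  by rewrite -ccompA p0 compm1.
have hk : h = a ;; tzero M ;; k.
  apply: (fibre_power_inj L).
    by rewrite -!ccompA kb -(L.1 ord0) ccompA h0 -ccompA.
  move=> i; rewrite -!ccompA kl /f; case: eqP => [->|/eqP i0].
    by rewrite compm1.
  have -> : i = ord_max by apply/val_inj; case: i i0 => [[|[|]]].
  by rewrite h1 [in RHS](ccompA (tzero M)) p0 comp1m.
by rewrite hk -ccompA (bundle_addr0 (tadd M)) ?compm1 //; split; rewrite kl.
Qed.

Lemma tpow_map_ex M N n (f : hom M N) :
  {h : hom (apex (tpow M n)) (apex (tpow N n)) | is_fibre_map (fmap tan f) f h}.
Proof.
apply: (fibre_power_ex (tpow_lim N n 0)) => i.
by rewrite -ccompA tproj_nat ccompA (tpow_lim M n 0).1.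
Qed.

Lemma pow_flow_plus M (g : hom (C ** M) M) :
  flow_preserved (pow_flow_map 2 g) (tan_flow_map g) (tplus M).
Proof.
have L := tpow_lim M 2 0; have L' := tpow_lim (C ** M) 2 0.
pose z i := pmap (tzero C) (leg (tpow M 2) i) ;; tprod C M.
have [|a [ab al]] := fibre_power_ex L' (r := pmap (idm C) (base (tpow M 2)))
  (f := z).
  move=> i; rewrite /z; apply: pair_ext; rewrite -!ccompA -tproj_nat; cart.
    by rewrite (bundle_zero (tadd (C : X))); cart.
  by rewrite (L.1 i).
have [Tg [Tgb Tgl]] := tpow_map_ex 2 g.
have -> : pow_flow_map 2 g = a ;; Tg.
  apply: (fibre_power_inj L) => [|i].
    by rewrite pow_flow_base -ccompA Tgb ccompA ab.
  rewrite pow_flow_leg -ccompA Tgl ccompA al /z /tan_flow_map.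
  by rewrite !ccompA; congr (_ ;; _); apply: tan_ext; cart.
rewrite /flow_preserved -ccompA -(tplus_nat (f := g)) //.
rewrite /tan_flow_map !ccompA; congr (_ ;; _); apply: tan_ext.
  have [q0 qP] := tpow_map_ex 2 (@pr0 X C M).
  rewrite -ccompA (tplus_nat qP) ccompA (plus_zero_zero (a := pr0)).
  - by cart.
  - by rewrite -ccompA qP.2 ccompA al /z; cart.
  - by rewrite -ccompA qP.2 ccompA al /z; cart.
have [q1 qP] := tpow_map_ex 2 (@pr1 X C M).
rewrite -ccompA (tplus_nat qP) ccompA.
have -> : a ;; q1 = pr1.
  apply: (fibre_power_inj L) => [|i].
    by rewrite -ccompA qP.1 ccompA ab; cart.
  by rewrite -ccompA qP.2 ccompA al /z; cart.
by cart.
Qed.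

Lemma flow_reflect (I : Type) (L : X) (B : I -> X)
    (l : forall i, hom L (B i)) (g : hom (C ** L) L)
    (gB : forall i, hom (C ** B i) (B i)) :
  jointly_monic l -> (forall i, flow_preserved g (gB i) (l i)) ->
  forall N (gN : hom (C ** N) N) (h : hom N L),
    (forall i, flow_preserved gN (gB i) (h ;; l i)) -> flow_preserved gN g h.
Proof.
move=> ml e N gN h eh; apply: ml => i.
rewrite -ccompA (eh i) -ccompA (e i); by cart.
Qed.

Definition flow_structure : tangent_structure X.
Proof.
refine (@TangentStructure X (flow C)
  (fun M N g1 g2 => flow_preserved (sval g1) (sval g2)) _ _
  (fun M g => exist _ (tan_flow_map (sval g)) (tan_flow_map_flow (svalP g)))
  _ _ _ _ _
  (fun M n g =>
     exist _ (pow_flow_map n (sval g)) (pow_flow_map_flow n (svalP g)))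
  _ _ _ _).
- move=> M s; rewrite /flow_preserved compm1 -[LHS]comp1m; congr (_ ;; _).
  by apply: pair_ext; cart.
- move=> M N P s t u f g e1 e2.
  by rewrite /flow_preserved ccompA e1 -ccompA e2; cart.
- by move=> M N s t f; exact: tan_flow_map_preserved.
- by move=> M s; exact: tan_flow_proj.
- by move=> M s; exact: tan_flow_zero.
- by move=> M s; exact: tan_flow_lift.
- by move=> M s; exact: tan_flow_flip.
- by move=> M n s; exact: pow_flow_base.
- by move=> M n s; exact: pow_flow_leg.
- by move=> M s; exact: pow_flow_plus.
- by move=> I L B s t l ml _ e N r h; exact: flow_reflect.
Defined.

End FlowStructure.

Section Flow.
Variables (X : cartesian_tangent_category) (C : curve_object X).

Lemma prd_flow_map_pr0 (M N : X) (g1 : hom (C ** M) M) (g2 : hom (C ** N) N) :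
  flow_preserved (prd_flow_map g1 g2) g1 pr0.
Proof. by rewrite /flow_preserved /prd_flow_map pair_pr0. Qed.

Lemma prd_flow_map_pr1 (M N : X) (g1 : hom (C ** M) M) (g2 : hom (C ** N) N) :
  flow_preserved (prd_flow_map g1 g2) g2 pr1.
Proof. by rewrite /flow_preserved /prd_flow_map pair_pr1. Qed.

Lemma prd_flow_map_flow (M N : X) (g1 : hom (C ** M) M)
    (g2 : hom (C ** N) N) :
  is_flow g1 -> is_flow g2 -> is_flow (prd_flow_map g1 g2).
Proof.
move=> f1 f2; pose gB (i : bool) :=
  match i return hom (C ** (if i then M else N)) (if i then M else N) with
  | true => g1 | false => g2 end.
apply: (jointly_monic_flow (gB := gB) (@prd_legs_monic X M N)).
  by case.
by case=> /=; [exact: prd_flow_map_pr0|exact: prd_flow_map_pr1].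
Qed.

Lemma bang_flow : is_flow (C := C) (bang (C ** one)).
Proof. by split; exact: bang_eq. Qed.

Lemma pr1_flow (M : X) : is_flow (C := C) (@pr1 X C M).
Proof. by split; cart. Qed.

Definition flow_cartesian_structure : cartesian_structure X.
Proof.
refine (@CartesianStructure X (flow_structure C) (exist _ _ bang_flow)
  (fun M N g1 g2 => exist _ (prd_flow_map (sval g1) (sval g2))
     (prd_flow_map_flow (svalP g1) (svalP g2))) _ _ _).
- by move=> M s; exact: bang_eq.
- by move=> M N s t; exact: prd_flow_map_pr0.
- by move=> M N s t; exact: prd_flow_map_pr1.
Defined.

(* FLOW(X): objects (M, gamma) with gamma a flow, T(M, gamma) =
   (TM, (0 x 1)T(gamma)), maps those f with gamma_1 f = (1 x f)gamma_2. *)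
Definition FLOW : cartesian_tangent_category :=
  total_cartesian flow_cartesian_structure.

Definition FLOW_ob (M : X) (g : flow C M) : FLOW := existT _ M g.

Definition FLOW_C : FLOW := FLOW_ob (exist _ _ (pr1_flow C)).

Lemma FLOW_c1_preserved :
  strhom (projT2 FLOW_C) (projT2 (total_tan flow_cartesian_structure FLOW_C))
    (ds_vf C).
Proof. by rewrite /= /flow_preserved /= /tan_flow_map; cart. Qed.

Lemma FLOW_c0_preserved :
  strhom (projT2 (one : FLOW)) (projT2 FLOW_C) (ds_pt C).
Proof.
by rewrite /= /flow_preserved /=; cart; congr (_ ;; _); exact: bang_eq.
Qed.

Lemma FLOW_sigma_preserved :
  strhom (projT2 (FLOW_C ** FLOW_C)) (projT2 FLOW_C) (co_sigma C).
Proof.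
rewrite /= /flow_preserved /= /prd_flow_map; cart.
by rewrite -[in LHS]comp_pair -[RHS]comp1m ccompA; congr (_ ;; _);
  apply: pair_ext; cart.
Qed.

Lemma FLOW_c1_vf : is_vector_field (exist _ _ FLOW_c1_preserved :
  hom FLOW_C (tan FLOW_C)).
Proof. by apply: sval_inj; exact: ds_vfP. Qed.

Definition FLOW_ds : dynamical_system FLOW :=
  @DynamicalSystem FLOW FLOW_C (exist _ _ FLOW_c1_preserved)
    (exist _ _ FLOW_c0_preserved) FLOW_c1_vf.

Definition FLOW_curve : curve_object FLOW.
Proof.
refine (@CurveObject FLOW FLOW_ds _ _ (exist _ _ FLOW_sigma_preserved) _).
- move=> M N V g x y Vp [x0 x1] [y0 y1]; apply: sval_inj.
  apply: (co_preinitial (V := sval V) (g := sval g)).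
  + exact: (congr1 sval Vp).
  + by split; [exact: (congr1 sval x0)|exact: (congr1 sval x1)].
  + by split; [exact: (congr1 sval y0)|exact: (congr1 sval y1)].
- by apply: sval_inj; exact: co_comm.
- by split; apply: sval_inj; [exact: (co_sigmaP C).1|exact: (co_sigmaP C).2].
Defined.

End Flow.

Section CompleteVectorFields.
Variables (X : cartesian_tangent_category) (C : curve_object X).
Implicit Types M N : X.

Definition vf_preserved M N (V : hom M (tan M)) (W : hom N (tan N))
    (f : hom M N) := V ;; fmap tan f = f ;; W.

Definition tan_vf_map M (V : hom M (tan M)) : hom (tan M) (tan (tan M)) :=
  fmap tan V ;; tflip M.

Definition prd_vf_map M N (V : hom M (tan M)) (W : hom N (tan N)) :
    hom (M ** N) (tan (M ** N)) := pmap V W ;; tprod M N.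

Definition is_cvf M (V : hom M (tan M)) := is_vector_field V /\ is_complete C V.

Lemma complete_id M (V : hom M (tan M)) (d : hom (C ** M) M) :
  is_solution (C := C) V (idm M) d -> is_complete C V.
Proof.
move=> [d0 d1] N g; exists (pmap (idm C) g ;; d); split.
  rewrite -[RHS]compm1 -d0; by cart.
rewrite -[RHS]ccompA -d1 fmapM !ccompA; congr (_ ;; _); apply: tan_ext; cart.
  by [].
by rewrite tzero_nat.
Qed.

Lemma flip_proj M : tflip M ;; fmap tan (tproj M) = tproj (tan M).
Proof.
have e := bundle_mor_proj (tflip_bundle M); rewrite compm1 in e.
by rewrite -e ccompA tflipK comp1m.
Qed.

Lemma tan_vf_proj M (V : hom M (tan M)) :
  vf_preserved (tan_vf_map V) V (tproj M).
Proof. by rewrite /vf_preserved /tan_vf_map -ccompA flip_proj tproj_nat. Qed.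

Lemma tan_vf_vf M (V : hom M (tan M)) :
  is_vector_field V -> is_vector_field (tan_vf_map V).
Proof.
rewrite /is_vector_field /tan_vf_map => e.
by rewrite -ccompA (bundle_mor_proj (tflip_bundle M)) compm1 -fmapM e fmap1.
Qed.

Lemma tan_solution M (V : hom M (tan M)) (d : hom (C ** M) M) :
  is_solution (C := C) V (idm M) d ->
  is_solution (C := C) (tan_vf_map V) (idm (tan M)) (tan_flow_map d).
Proof.
move=> [d0 d1]; split.
  transitivity (fmap tan (at_zero C M) ;; fmap tan d); last first.
    by rewrite -fmapM d0 fmap1.
  rewrite /tan_flow_map !ccompA; congr (_ ;; _).
  apply: tan_ext; cart => //.
  by rewrite tzero_nat ccompA; congr (_ ;; _); exact: tone_eq.
transitivity (pmap (tzero C) (idm (tan M)) ;; tprod C M ;;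
  fmap tan (d ;; V) ;; tflip M); last first.
  by rewrite /tan_vf_map /tan_flow_map fmapM !ccompA.
rewrite -d1 /tan_flow_map !fmapM -!ccompA tflip_nat !ccompA; congr (_ ;; _).
have zf (N : X) : tzero (tan N) ;; tflip N = fmap tan (tzero N).
  by rewrite -zero_flip -ccompA tflipK compm1.
apply: tan2_ext; rewrite -!ccompA -tflip_nat.
  rewrite ftprod0 [fmap tan (tprod _ _) ;; _]ccompA ftprod0; cart.
  by rewrite -zf; congr (_ ;; _); rewrite !ccompA tzero_nat.
rewrite ftprod1 [fmap tan (tprod _ _) ;; _]ccompA ftprod1; cart.
by rewrite zero_flip.
Qed.

Lemma tan_cvf M (V : hom M (tan M)) : is_cvf V -> is_cvf (tan_vf_map V).
Proof.
move=> [V0 V1]; split; first exact: tan_vf_vf.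
have [d dP] := V1 _ (idm M).
exact: complete_id (tan_solution dP).
Qed.

Lemma jointly_monic_vf (I : Type) (L : X) (B : I -> X)
    (l : forall i, hom L (B i)) (V : hom L (tan L))
    (VB : forall i, hom (B i) (tan (B i))) :
  jointly_monic l -> (forall i, is_vector_field (VB i)) ->
  (forall i, vf_preserved V (VB i) (l i)) -> is_vector_field V.
Proof.
move=> ml vB e; apply: ml => i.
by rewrite -ccompA -tproj_nat ccompA e -ccompA vB compm1 comp1m.
Qed.

Lemma jointly_monic_solution (I : Type) (L : X) (B : I -> X)
    (l : forall i, hom L (B i)) (V : hom L (tan L))
    (VB : forall i, hom (B i) (tan (B i))) (d : hom (C ** L) L)
    (dB : forall i, hom (C ** B i) (B i)) :
  jointly_monic l -> jointly_monic (fun i => fmap tan (l i)) ->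
  (forall i, is_solution (C := C) (VB i) (idm (B i)) (dB i)) ->
  (forall i, vf_preserved V (VB i) (l i)) ->
  (forall i, flow_preserved d (dB i) (l i)) ->
  is_solution (C := C) V (idm L) d.
Proof.
move=> ml mTl sB e eB; split.
  apply: ml => i; rewrite -ccompA eB comp1m -[RHS]compm1 -(sB i).1; by cart.
apply: mTl => i; rewrite -[in RHS]ccompA e [RHS]ccompA eB.
rewrite -[RHS]ccompA -(sB i).2.
rewrite -ccompA -fmapM eB fmapM !ccompA; congr (_ ;; _).
apply: tan_ext; cart; first by [].
by rewrite tzero_nat.
Qed.

Lemma pow_vf_ex M n (V : hom M (tan M)) :
  {W : hom (apex (tpow M n)) (tan (apex (tpow M n))) |
    vf_preserved W V (base (tpow M n)) /\
    forall i, vf_preserved W (tan_vf_map V) (leg (tpow M n) i)}.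
Proof.
apply: (fibre_power_ex (tpow_lim M n 1)
  (f := fun i => leg (tpow M n) i ;; tan_vf_map V)); move=> i /=.
by rewrite -ccompA tan_vf_proj ccompA (tpow_lim M n 0).1.
Qed.

Definition pow_vf_map M n (V : hom M (tan M)) := sval (pow_vf_ex n V).

Lemma pow_vf_base M n (V : hom M (tan M)) :
  vf_preserved (pow_vf_map n V) V (base (tpow M n)).
Proof. exact: (svalP (pow_vf_ex n V)).1. Qed.

Lemma pow_vf_leg M n (V : hom M (tan M)) i :
  vf_preserved (pow_vf_map n V) (tan_vf_map V) (leg (tpow M n) i).
Proof. exact: (svalP (pow_vf_ex n V)).2. Qed.

Lemma pow_cvf M n (V : hom M (tan M)) : is_cvf V -> is_cvf (pow_vf_map n V).
Proof.
move=> VP; have TP := tan_cvf VP.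
have ml := fibre_power_monic (tpow_lim M n 0).
have mTl := fibre_power_image_monic (tpow_lim M n 1).
pose VB (i : option 'I_n) :=
  match i return hom (if i is Some _ then tan M else M)
                   (tan (if i is Some _ then tan M else M)) with
  | Some _ => tan_vf_map V | None => V end.
have e i : vf_preserved (pow_vf_map n V) (VB i) (fcone_legs (tpow M n) i).
  by case: i => [i|]; [exact: pow_vf_leg|exact: pow_vf_base].
split; first by apply: (jointly_monic_vf ml (VB := VB)) => // -[i|];
  [exact: TP.1|exact: VP.1].
have [d dP] := VP.2 _ (idm M).
pose dB (i : option 'I_n) :=
  match i return hom (C ** (if i is Some _ then tan M else M))
                     (if i is Some _ then tan M else M) with
  | Some _ => tan_flow_map d | None => d end.
apply: (complete_id (d := pow_flow_map n d)).
apply: (jointly_monic_solution (VB := VB) (dB := dB) ml mTl) => //.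
  by move=> [i|] //=; exact: tan_solution.
by move=> [i|]; [exact: pow_flow_leg|exact: pow_flow_base].
Qed.

Lemma vf_preserved_zero M (V : hom M (tan M)) :
  vf_preserved V (tan_vf_map V) (tzero M).
Proof.
rewrite /vf_preserved /tan_vf_map ccompA -tzero_nat -ccompA -zero_flip.
by rewrite -(ccompA _ (tflip M)) tflipK compm1.
Qed.

Lemma vf_preserved_lift M (V : hom M (tan M)) :
  vf_preserved (tan_vf_map V) (tan_vf_map (tan_vf_map V)) (tlift M).
Proof.
rewrite /vf_preserved /tan_vf_map -ccompA -tlift_flip_flip fmapM !ccompA.
by rewrite tlift_nat.
Qed.

Lemma vf_preserved_flip M (V : hom M (tan M)) :
  vf_preserved (tan_vf_map (tan_vf_map V)) (tan_vf_map (tan_vf_map V))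
    (tflip M).
Proof.
rewrite /vf_preserved /tan_vf_map !fmapM !ccompA -tflip_nat -!ccompA.
by congr (_ ;; _); rewrite !ccompA tflip_braid.
Qed.

Lemma vf_preserved_plus M (V : hom M (tan M)) :
  vf_preserved (pow_vf_map 2 V) (tan_vf_map V) (tplus M).
Proof.
rewrite /vf_preserved /tan_vf_map ccompA.
have [TV TVP] := tpow_map_ex 2 V.
rewrite (tplus_nat TVP).
have L1 := tpow_lim M 2 1; have LT := tpow_lim (tan M) 2 0.
have pf := bundle_mor_proj (tflip_bundle M); rewrite compm1 in pf.
have [|k [kb kl]] := fibre_power_ex LT
  (r := fmap tan (base (tpow M 2)))
  (f := fun i => fmap tan (leg (tpow M 2) i) ;; tflip M).
  by move=> i; rewrite -ccompA pf -fmapM (tpow_lim M 2 0).1.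
have kP : fmap tan (tplus M) ;; tflip M = k ;; tplus (tan M).
  apply: (bundle_mor_plus (tflip_bundle M)); split=> [|i] /=.
    by rewrite kb compm1.
  exact: kl.
have -> : TV = pow_vf_map 2 V ;; k.
  apply: (fibre_power_inj LT) => [|i].
    by rewrite TVP.1 -ccompA kb pow_vf_base.
  rewrite TVP.2 -ccompA kl ccompA pow_vf_leg /tan_vf_map -!ccompA tflipK.
  by rewrite compm1.
by rewrite -(ccompA _ k) -kP -!ccompA tflipK compm1.
Qed.

Lemma vf_reflect (I : Type) (L : X) (B : I -> X)
    (l : forall i, hom L (B i)) (V : hom L (tan L))
    (VB : forall i, hom (B i) (tan (B i))) :
  jointly_monic (fun i => fmap tan (l i)) ->
  (forall i, vf_preserved V (VB i) (l i)) ->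
  forall N (W : hom N (tan N)) (h : hom N L),
    (forall i, vf_preserved W (VB i) (h ;; l i)) -> vf_preserved W V h.
Proof.
move=> ml e N W h eh; apply: ml => i.
by rewrite -ccompA -fmapM (eh i) -!ccompA (e i).
Qed.

Definition cvf M := {V : hom M (tan M) | is_cvf V}.

Definition cvf_structure : tangent_structure X.
Proof.
refine (@TangentStructure X cvf
  (fun M N V W => vf_preserved (sval V) (sval W)) _ _
  (fun M V => exist _ (tan_vf_map (sval V)) (tan_cvf (svalP V)))
  _ _ _ _ _
  (fun M n V => exist _ (pow_vf_map n (sval V)) (pow_cvf n (svalP V)))
  _ _ _ _).
- by move=> M s; rewrite /vf_preserved fmap1 compm1 comp1m.
- move=> M N P s t u f g e1 e2.
  by rewrite /vf_preserved fmapM ccompA e1 -ccompA e2 ccompA.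
- move=> M N s t f e; rewrite /vf_preserved /tan_vf_map /=.
  by rewrite -ccompA -tflip_nat ccompA -fmapM e fmapM -ccompA.
- by move=> M s; exact: tan_vf_proj.
- by move=> M s; exact: vf_preserved_zero.
- by move=> M s; exact: vf_preserved_lift.
- by move=> M s; exact: vf_preserved_flip.
- by move=> M n s; exact: pow_vf_base.
- by move=> M n s; exact: pow_vf_leg.
- by move=> M s; exact: vf_preserved_plus.
- by move=> I L B s t l _ ml e N r h; exact: vf_reflect.
Defined.

Lemma zero_cvf M : is_cvf (tzero M).
Proof.
split; first exact: (bundle_zero (tadd M)).
apply: (complete_id (d := pr1)); split; first by cart.
by cart.
Qed.

Lemma prd_vf_map_pr0 M N (V : hom M (tan M)) (W : hom N (tan N)) :
  vf_preserved (prd_vf_map V W) V pr0.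
Proof. by rewrite /vf_preserved /prd_vf_map; cart. Qed.

Lemma prd_vf_map_pr1 M N (V : hom M (tan M)) (W : hom N (tan N)) :
  vf_preserved (prd_vf_map V W) W pr1.
Proof. by rewrite /vf_preserved /prd_vf_map; cart. Qed.

Lemma prd_cvf M N (V : hom M (tan M)) (W : hom N (tan N)) :
  is_cvf V -> is_cvf W -> is_cvf (prd_vf_map V W).
Proof.
move=> VP WP; have ml := @prd_legs_monic X M N.
have mTl := @tan_prd_legs_monic X M N.
pose VB (i : bool) :=
  match i return hom (if i then M else N) (tan (if i then M else N)) with
  | true => V | false => W end.
have e i : vf_preserved (prd_vf_map V W) (VB i) (@prd_legs X M N i).
  by case: i; [exact: prd_vf_map_pr0|exact: prd_vf_map_pr1].
split; first by apply: (jointly_monic_vf ml (VB := VB)) => // -[];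
  [exact: VP.1|exact: WP.1].
have [d dP] := VP.2 _ (idm M); have [d' dP'] := WP.2 _ (idm N).
pose dB (i : bool) :=
  match i return hom (C ** (if i then M else N)) (if i then M else N) with
  | true => d | false => d' end.
apply: (complete_id (d := prd_flow_map d d')).
apply: (jointly_monic_solution (VB := VB) (dB := dB) ml mTl) => //.
  by case.
by case; [exact: prd_flow_map_pr0|exact: prd_flow_map_pr1].
Qed.

Definition cvf_cartesian_structure : cartesian_structure X.
Proof.
refine (@CartesianStructure X cvf_structure (exist _ _ (zero_cvf one))
  (fun M N V W => exist _ (prd_vf_map (sval V) (sval W))
     (prd_cvf (svalP V) (svalP W))) _ _ _).
- by move=> M s; exact: tone_eq.
- by move=> M N s t; exact: prd_vf_map_pr0.
- by move=> M N s t; exact: prd_vf_map_pr1.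
Defined.

(* CVF(X): objects (M, V) with V a complete vector field, T(M, V) =
   (TM, T(V)c), maps those f with V_1 T(f) = f V_2. *)
Definition CVF : cartesian_tangent_category :=
  total_cartesian cvf_cartesian_structure.

Definition CVF_ob M (V : cvf M) : CVF := existT _ M V.

Definition CVF_C : CVF := CVF_ob (exist _ _ (zero_cvf C)).

Lemma CVF_c1_preserved :
  strhom (projT2 CVF_C) (projT2 (total_tan cvf_cartesian_structure CVF_C))
    (ds_vf C).
Proof. by rewrite /= /vf_preserved /= /tan_vf_map zero_flip tzero_nat. Qed.

Lemma CVF_c0_preserved :
  strhom (projT2 (one : CVF)) (projT2 CVF_C) (ds_pt C).
Proof. by rewrite /= /vf_preserved /= tzero_nat. Qed.

Lemma CVF_sigma_preserved :
  strhom (projT2 (CVF_C ** CVF_C)) (projT2 CVF_C) (co_sigma C).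
Proof.
rewrite /= /vf_preserved /= tzero_nat /prd_vf_map; congr (_ ;; _).
by apply: tan_ext; cart; rewrite tzero_nat.
Qed.

Lemma CVF_c1_vf : is_vector_field (exist _ _ CVF_c1_preserved :
  hom CVF_C (tan CVF_C)).
Proof. by apply: sval_inj; exact: ds_vfP. Qed.

Definition CVF_ds : dynamical_system CVF :=
  @DynamicalSystem CVF CVF_C (exist _ _ CVF_c1_preserved)
    (exist _ _ CVF_c0_preserved) CVF_c1_vf.

Definition CVF_curve : curve_object CVF.
Proof.
refine (@CurveObject CVF CVF_ds _ _ (exist _ _ CVF_sigma_preserved) _).
- move=> M N V g x y Vp [x0 x1] [y0 y1]; apply: sval_inj.
  apply: (co_preinitial (V := sval V) (g := sval g)).
  + exact: (congr1 sval Vp).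
  + by split; [exact: (congr1 sval x0)|exact: (congr1 sval x1)].
  + by split; [exact: (congr1 sval y0)|exact: (congr1 sval y1)].
- by apply: sval_inj; exact: co_comm.
- by split; apply: sval_inj; [exact: (co_sigmaP C).1|exact: (co_sigmaP C).2].
Defined.

End CompleteVectorFields.

(* Main.v *)
Require Import Defs.
From mathcomp Require Import all_boot.

(** A map of [FLOW X] or of [CVF X] is a map of [X] with a preservation
property, and the terminal object, the products and the curve object of both
categories are those of [X] with extra structure.  The equations defining a
flow therefore hold for a map upstairs exactly when they hold for the
underlying map ([FLOW_is_flow], [CVF_is_flow]), and a flow upstairs is a flow
[g] of [X] that preserves the structure.

In [FLOW X], the object [C] carries the flow [pr1], so the product flow on
[C ** M] sends [(s, (t, m))] to [(t, g1 (s, m))]; preservation by [g2] reads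
[g2 (t, g1 (s, m)) = g1 (s, g2 (t, m))], which is commutation up to
reassociating the domain ([flows_commuteP]).  In [CVF X], the object [C]
carries the zero vector field, and preservation by [g] is literally the
invariance of [V] under [g], with its two sides exchanged ([is_invariantP]).
The property of being a flow and the preservation property being
proof-irrelevant, both correspondences are bijective. *)

Section FlowsOfFlows.
Variables (X : cartesian_tangent_category) (C : curve_object X).

(** A section of the associator, in fact its inverse. *)
Definition unassoc (A B D : X) : hom (A ** (B ** D)) ((A ** B) ** D) :=
  pairing (pairing pr0 (pr1 ;; pr0)) (pr1 ;; pr1).

Lemma unassocK (A B D : X) : unassoc A B D ;; assoc A B D = idm _.
Proof.
by rewrite /unassoc; apply: pair_ext; cart => //; apply: pair_ext; cart.
Qed.

Lemma assoc_epi (A B D E : X) (f g : hom (A ** (B ** D)) E) :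
  assoc A B D ;; f = assoc A B D ;; g -> f = g.
Proof.
by move=> e; rewrite -(comp1m f) -(comp1m g) -unassocK -!ccompA e.
Qed.

(** The right-hand side says that [g2] is a map from [(C, pr1)] times [(M, g1)]
to [(M, g1)] in [FLOW X]; its domain is [C ** (C ** M)], whereas commutation is
stated on [(C ** C) ** M]. *)
Lemma flows_commuteP (M : X) (g1 g2 : hom (C ** M) M) :
  flows_commute g1 g2 <-> flow_preserved (prd_flow_map pr1 g1) g1 g2.
Proof.
have eL : assoc C C M ;; (prd_flow_map pr1 g1 ;; g2) =
    Defs.pmap (twist C C) (idm M) ;; assoc C C M ;; Defs.pmap (idm C) g1 ;; g2.
  by rewrite /prd_flow_map; cart.
rewrite /flows_commute /flow_preserved -eL -(ccompA (assoc C C M)).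
by split=> [/assoc_epi|->].
Qed.

Lemma FLOW_is_flow (M : X) (g1 : flow C M)
    (g : hom (FLOW_curve C ** FLOW_ob g1) (FLOW_ob g1)) :
  is_flow (C := FLOW_curve C) g <-> is_flow (C := C) (M := M) (sval g).
Proof.
split=> -[g0 gA]; split.
- exact: (congr1 sval g0).
- exact: (congr1 sval gA).
- by apply: sval_inj; exact: g0.
- by apply: sval_inj; exact: gA.
Qed.

(** A flow [((M, g1), g2)] in [FLOW X], seen as the pair of commuting flows
[(g1, g2)] on [M]. *)
Definition commuting_flows (M : X)
    (F : {g1 : flow C M & flow (FLOW_curve C) (FLOW_ob g1)}) :
    {g : flow C M * flow C M | flows_commute (sval g.1) (sval g.2)} :=
  let g2 := projT2 F in
  exist _
    (projT1 F, exist _ (sval (sval g2)) ((FLOW_is_flow _ _ _).1 (svalP g2)))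
    ((flows_commuteP _ _ _).2 (svalP (sval g2))).

(** The flow [((M, g1), g2)] in [FLOW X] given by a pair of commuting flows. *)
Definition flow_of_commuting_flows (M : X)
    (G : {g : flow C M * flow C M | flows_commute (sval g.1) (sval g.2)}) :
    {g1 : flow C M & flow (FLOW_curve C) (FLOW_ob g1)} :=
  let g1 := (sval G).1 in let g2 := (sval G).2 in
  let h : hom (FLOW_curve C ** FLOW_ob g1) (FLOW_ob g1) :=
    exist _ (sval g2) ((flows_commuteP _ _ _).1 (svalP G)) in
  existT _ g1 (exist _ h ((FLOW_is_flow _ _ h).2 (svalP g2))).

Lemma commuting_flows_bij (M : X) : bijective (commuting_flows M).
Proof.
exists (flow_of_commuting_flows M).
  move=> [g1 g2]; apply: (congr1 (existT _ g1)).
  by apply: sval_inj; apply: sval_inj.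
case=> -[g1 g2] e; apply: sval_inj; congr pair; exact: sval_inj.
Qed.

End FlowsOfFlows.

Section FlowsOfVectorFields.
Variables (X : cartesian_tangent_category) (C : curve_object X).
Variables (M : X) (V : cvf C M).

Lemma is_invariantP (g : hom (C ** M) M) :
  is_invariant (sval V) g <->
  vf_preserved (prd_vf_map (tzero C) (sval V)) (sval V) g.
Proof. by split. Qed.

Lemma CVF_is_flow (g : hom (CVF_curve C ** CVF_ob V) (CVF_ob V)) :
  is_flow (C := CVF_curve C) g <-> is_flow (C := C) (M := M) (sval g).
Proof.
split=> -[g0 gA]; split.
- exact: (congr1 sval g0).
- exact: (congr1 sval gA).
- by apply: sval_inj; exact: g0.
- by apply: sval_inj; exact: gA.
Qed.

(** A flow [((M, V), g)] in [CVF X], seen as the flow [g] on [M], under which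
[V] is invariant. *)
Definition invariant_flow (F : flow (CVF_curve C) (CVF_ob V)) :
    {g : flow C M | is_invariant (sval V) (sval g)} :=
  exist _ (exist _ (sval (sval F)) ((CVF_is_flow _).1 (svalP F)))
    ((is_invariantP _).2 (svalP (sval F))).

(** The flow [((M, V), g)] in [CVF X] given by a flow [g] under which [V] is
invariant. *)
Definition flow_of_invariant_flow
    (G : {g : flow C M | is_invariant (sval V) (sval g)}) :
    flow (CVF_curve C) (CVF_ob V) :=
  let h : hom (CVF_curve C ** CVF_ob V) (CVF_ob V) :=
    exist _ (sval (sval G)) ((is_invariantP _).1 (svalP G)) in
  exist _ h ((CVF_is_flow h).2 (svalP (sval G))).

Lemma invariant_flow_bij : bijective invariant_flow.
Proof. by exists flow_of_invariant_flow => F; do 2!apply: sval_inj. Qed.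

End FlowsOfVectorFields.

Theorem proposition4p36 (X : cartesian_tangent_category) (C : curve_object X) :
  (forall M : X,
    exists Phi : {g1 : flow C M & flow (FLOW_curve C) (FLOW_ob g1)} ->
        {g : flow C M * flow C M | flows_commute (sval g.1) (sval g.2)},
      bijective Phi /\
      forall F, sval (sval (Phi F)).1 = sval (projT1 F) /\
                sval (sval (Phi F)).2 = sval (sval (projT2 F))) /\
  (forall (M : X) (V : cvf C M),
    exists Psi : flow (CVF_curve C) (CVF_ob V) ->
        {g : flow C M | is_invariant (sval V) (sval g)},
      bijective Psi /\
      forall F, sval (sval (Psi F)) = sval (sval F)).
Proof.
split=> [M|M V].
  by exists (commuting_flows X C M); split=> //; exact: commuting_flows_bij.
by exists (invariant_flow X C M V); split=> //; exact: invariant_flow_bij.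
Qed.
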